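(* For every integer $r\geq 1$, the $r$-dimensional Benes network $BN(r)$ satisfies ${\rm ip}_{c}(BN(r))={\rm ip}_{p}(BN(r))=2^r$.
   Context: The $r$-dimensional Benes network $BN(r)$ (two $r$-dimensional butterflies placed back to back, sharing their level-$r$ vertices) has vertex set $\{\langle w,i\rangle : w\in\{0,1\}^r,\ 0\le i\le 2r\}$, where $w=w_0w_1\cdots w_{r-1}$. For $0\le i<r$, $\langle w,i\rangle$ is adjacent to $\langle w',i+1\rangle$ iff $w=w'$ or $w,w'$ differ exactly in bit position $i$; for $r\le i<2r$, $\langle w,i\rangle$ is adjacent to $\langle w',i+1\rangle$ iff $w=w'$ or $w,w'$ differ exactly in bit position $2r-1-i$; there are no other edges. A path is isometric if its length equals the distance between its endpoints; single vertices count as paths. ${\rm ip}_{c}(H)$ (resp. ${\rm ip}_{p}(H)$) is the minimum number of isometric paths of $H$ whose vertex sets cover (resp. partition) $V(H)$. *)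

(* Defs.v *)
From mathcomp Require Import all_boot.
From mathcomp Require Import boolp.

Set Implicit Arguments.
Unset Strict Implicit.
Unset Printing Implicit Defensive.

Record sgraph := SGraph {
  vertex :> finType;
  adj : rel vertex;
  adj_sym : symmetric adj;
  adj_irrefl : irreflexive adj
}.

Section IsometricPaths.
Variable H : sgraph.
Implicit Types (x y : H) (s p : seq H) (ps : seq (seq H)).

(* A path is given by the nonempty list of its successive vertices; its length
   is the number of its edges, that is (size s).-1. *)
Definition is_path s : bool :=
  if s is x :: p then path (@adj H) x p && uniq s else false.

Definition path_between x y s : bool :=
  [&& is_path s, head y s == x & last x s == y].

(* "x and y are connected, at distance d" *)
Definition is_dist x y (d : nat) : Prop :=
  (exists2 s, path_between x y s & (size s).-1 = d) /\
  (forall s, path_between x y s -> d <= (size s).-1).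

Definition isometric_path s : Prop :=
  is_path s /\ (forall x y, path_between x y s -> is_dist x y (size s).-1).

Definition isometric_cover ps : Prop :=
  (forall s, s \in ps -> isometric_path s) /\
  (forall x, exists2 s, s \in ps & x \in s).

Definition isometric_partition ps : Prop :=
  isometric_cover ps /\ pairwise (fun s s' => [disjoint s & s']) ps.

Lemma isometric_path1 x : isometric_path [:: x].
Proof.
split=> // a b /and3P[_ /= /eqP<- /eqP<-].
by split=> //; exists [:: x] => //; rewrite /path_between /= !eqxx.
Qed.

Lemma isometric_partition_singletons :
  isometric_partition [seq [:: x] | x <- enum H].
Proof.
split; first split.
- by move=> s /mapP[x _ ->]; apply: isometric_path1.
- by move=> x; exists [:: x]; rewrite ?inE // map_f ?mem_enum.
- rewrite pairwise_map; have := enum_uniq H; rewrite uniq_pairwise.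
  apply: sub_pairwise => x y /= nxy.
  by rewrite disjoint_has /= inE orbF.
Qed.

Lemma isometric_cover_exists :
  exists n, `[< exists2 ps, isometric_cover ps & size ps = n >].
Proof.
exists (size [seq [:: x] | x <- enum H]); apply/asboolP.
by exists [seq [:: x] | x <- enum H]; case: isometric_partition_singletons.
Qed.

Lemma isometric_partition_exists :
  exists n, `[< exists2 ps, isometric_partition ps & size ps = n >].
Proof.
exists (size [seq [:: x] | x <- enum H]); apply/asboolP.
by exists [seq [:: x] | x <- enum H] => //; exact: isometric_partition_singletons.
Qed.

Definition ip_c : nat := ex_minn isometric_cover_exists.

Definition ip_p : nat := ex_minn isometric_partition_exists.

End IsometricPaths.

Section Benes.
Variable r : nat.

Definition benes_vertex : finType := (r.-tuple bool * 'I_(2 * r).+1)%type.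

(* The bit position flipped by the cross edges between levels i and i.+1. *)
Definition benes_bit (i : nat) : nat := if i < r then i else 2 * r - 1 - i.

Definition differ_exactly_at (k : nat) (w w' : r.-tuple bool) : bool :=
  [forall j : 'I_r, (tnth w j != tnth w' j) == (j == k :> nat)].

Definition benes_up : rel benes_vertex := fun u v =>
  (v.2 == u.2.+1 :> nat) &&
  ((u.1 == v.1) || differ_exactly_at (benes_bit u.2) u.1 v.1).

Definition benes_adj : rel benes_vertex := fun u v => benes_up u v || benes_up v u.

Lemma benes_adj_sym : symmetric benes_adj.
Proof. by move=> u v; rewrite /benes_adj orbC. Qed.

Lemma benes_adj_irrefl : irreflexive benes_adj.
Proof. by move=> u; rewrite /benes_adj /benes_up orbb eq_sym gtn_eqF. Qed.

Definition BN : sgraph := SGraph benes_adj_sym benes_adj_irrefl.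

End Benes.

(* Main.v *)
(* Consecutive vertices lie on consecutive levels, so the row of [w], going
   straight from level 0 to level 2r, is isometric; the 2^r rows partition the
   network.  Conversely the diameter is at most 2r, so an isometric path has at
   most 2r+1 vertices, and covering the 2^r(2r+1) vertices takes at least 2^r
   paths. *)
Require Import Defs.
From mathcomp Require Import all_boot.
From mathcomp Require Import boolp zify.

Set Implicit Arguments.
Unset Strict Implicit.
Unset Printing Implicit Defensive.

Section Walks.
Variable H : sgraph.
Implicit Types (x y z : H) (s p : seq H) (ps : seq (seq H)).

(** Vertices may repeat, so that walks concatenate freely; a walk is shortened to a path only for
    the comparison with an isometric path. *)
Definition walk (n : nat) x y : Prop :=
  exists2 p, path (@adj H) x p & last x p = y /\ size p = n.

Lemma walk0 x : walk 0 x x.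
Proof. by exists [::]. Qed.

Lemma walkS n x y z : adj x y -> walk n y z -> walk n.+1 x z.
Proof.
by move=> xy [p yp [<- <-]]; exists (y :: p); rewrite //= xy.
Qed.

Lemma walk_cat m n x y z : walk m x y -> walk n y z -> walk (m + n) x z.
Proof.
move=> [p xp [py <-]] [q yq [<- <-]]; exists (p ++ q).
  by rewrite cat_path xp py.
by rewrite last_cat py size_cat.
Qed.

Lemma walk_sym n x y : walk n x y -> walk n y x.
Proof.
move=> [p xp [<- <-]]; exists (rev (belast x p)).
  by rewrite rev_path (eq_path (e' := @adj H)) // => u v; rewrite adj_sym.
rewrite size_rev size_belast; split=> //.
by case: p {xp} => //= y' p; rewrite rev_cons last_rcons.
Qed.

Lemma walk_path_between n x y :
  walk n x y -> exists2 s, path_between x y s & size s <= n.+1.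
Proof.
move=> [p xp [<- <-]]; case: (shortenP xp) => q xq uq sub_qp.
exists (x :: q); first by rewrite /path_between /is_path xq uq /= !eqxx.
by case/andP: uq => _ uq; rewrite ltnS (uniq_leq_size uq).
Qed.

(** A walk of at most [d] edges between the ends of [s] shortens to a path, and an isometric path is
    no longer than any path with the same ends. *)
Lemma isometric_path_size d s :
  (forall x y, exists2 n, n <= d & walk n x y) ->
  isometric_path s -> size s <= d.+1.
Proof.
move=> diam []; case: s => // x p ps /(_ x (last x p)) [].
  by rewrite /path_between ps /= !eqxx.
move=> _ min_p; have [n le_nd /walk_path_between[s /min_p]] := diam x (last x p).
by rewrite /=; lia.
Qed.

Lemma isometric_cover_card d ps :
  (forall x y, exists2 n, n <= d & walk n x y) ->
  isometric_cover ps -> #|H| <= size ps * d.+1.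
Proof.
move=> diam [iso_ps cov_ps].
have le_card: #|H| <= size (flatten ps).
  rewrite cardE; apply: uniq_leq_size (enum_uniq _) _ => x _.
  by apply/flattenP.
apply: leq_trans le_card _; elim: ps iso_ps {cov_ps} => //= s ps IHps iso_ps.
rewrite size_cat mulSn leq_add ?IHps //.
  by apply: isometric_path_size diam (iso_ps _ _); rewrite mem_head.
by move=> t t_ps; apply: iso_ps; rewrite inE t_ps orbT.
Qed.

(** A partition is also a cover, so one partition attaining the lower bound for covers settles both
    minima. *)
Lemma ip_c_ip_p_eq n ps :
  isometric_partition ps -> size ps = n ->
  (forall qs : seq (seq H), isometric_cover qs -> n <= size qs) ->
  ip_c H = n /\ ip_p H = n.
Proof.
move=> part_ps sz_ps min_n; rewrite /ip_c /ip_p; split; case: ex_minnP => m.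
  move=> /asboolP[qs /min_n le_n <-] min_m; apply/eqP; rewrite eqn_leq le_n andbT.
  by apply: min_m; apply/asboolP; exists ps => //; case: part_ps.
move=> /asboolP[qs [/min_n le_n _] <-] min_m; apply/eqP; rewrite eqn_leq le_n andbT.
by apply: min_m; apply/asboolP; exists ps.
Qed.

End Walks.

Section BenesNetwork.
Variable r : nat.
Implicit Types (w : r.-tuple bool) (u v : BN r) (i j k : nat).

(** [inord] sends a level above [2 * r] to 0, hence the bounds on levels in the lemmas below. *)
Definition bvertex w i : BN r := (w, inord i).

Lemma bvertex_level w i : i <= 2 * r -> (bvertex w i).2 = i :> nat.
Proof. by move=> le_i; rewrite /= inordK. Qed.

Lemma bvertexK (u : BN r) : bvertex u.1 u.2 = u.
Proof. by case: u => w i; rewrite /bvertex /= inord_val. Qed.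

Lemma adj_level u v : adj u v -> v.2 <= u.2.+1.
Proof. by case/orP=> /andP[/eqP lv _]; lia. Qed.

Lemma path_level u (p : seq (BN r)) :
  path (@adj (BN r)) u p -> (last u p).2 <= u.2 + size p.
Proof.
elim: p u => [|v p IHp] u /=; first by rewrite addn0.
case/andP=> /adj_level uv /IHp /leq_trans; apply.
by rewrite addnS -addSn leq_add2r.
Qed.

(** The upward step from level [k] may set bit [benes_bit r k] at will, so a monotone climb can
    correct every position that it meets. *)
Lemma benes_up_walk w w' i j :
    i <= j <= 2 * r ->
    (forall t : 'I_r, tnth w t != tnth w' t ->
       exists2 k, i <= k < j & benes_bit r k = t) ->
  walk (j - i) (bvertex w i) (bvertex w' j).
Proof.
move=> /andP[le_ij le_j]; move def_n: (j - i) => n.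
elim: n w i le_ij def_n => [|n IHn] w i le_ij def_n flip.
  have -> : j = i by lia.
  suff -> : w = w' by apply: walk0.
  apply: eq_from_tnth => t; apply/eqP/negPn/negP => /flip[k]; lia.
set b := benes_bit r i.
(* The first step gives bit [b] its final value and leaves the others to the rest of the climb. *)
pose w2 := [tuple if t == b :> nat then tnth w' t else tnth w t | t < r].
apply: (@walkS _ n _ (bvertex w2 i.+1)); last first.
  apply: IHn; try lia.
  move=> t; rewrite tnth_mktuple; case: (t =P b :> nat) => [|ne_tb]; first by rewrite eqxx.
  move=> /flip[k lt_k bk]; exists k => //.
  have /eqP: k <> i by move=> ki; case: ne_tb; rewrite -bk ki.
  by lia.
apply/orP; left; rewrite /benes_up !bvertex_level ?eqxx /=; try lia.
(* On a cross edge, [w] and [w'] must disagree at [b]: otherwise [w2] would equal [w]. *)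
case: eqP => //= ne_w; rewrite -/b; apply/forallP => t.
rewrite tnth_mktuple; case: (eqVneq (t : nat) b) => [tb|_]; last by rewrite eqxx.
rewrite eqb_id; apply/eqP => eq_t; apply: ne_w; apply: eq_from_tnth => t'.
rewrite tnth_mktuple; case: eqP => // t'b.
by have -> : t' = t by apply: val_inj; rewrite /= tb.
Qed.

(** Subtraction is truncated, so the length is the absolute difference of [i] and [j]. *)
Lemma straight_walk w i j :
  i <= 2 * r -> j <= 2 * r ->
  walk ((i - j) + (j - i)) (bvertex w i) (bvertex w j).
Proof.
move=> le_i le_j; case: (leqP i j) => [le_ij | /ltnW le_ji].
  rewrite (eqP le_ij) add0n; apply: benes_up_walk => [|t]; first by rewrite le_ij.
  by rewrite eqxx.
rewrite (eqP le_ji) addn0; apply/walk_sym/benes_up_walk => [|t].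
  by rewrite le_ji.
by rewrite eqxx.
Qed.

(* Climbing from level [a] to level [b] meets every bit position. *)
Definition full_climb (a b : nat) : bool :=
  ((a == 0) && (r <= b <= 2 * r)) || ((a <= r) && (b == 2 * r)).

(** Go straight from level [i] to [a], correct all bits while climbing to [b], then go straight to
    [j]. *)
Lemma full_climb_walk a b w w' i j :
  full_climb a b -> i <= 2 * r -> j <= 2 * r ->
  walk ((i - a + (a - i)) + ((b - a) + (b - j + (j - b))))
       (bvertex w i) (bvertex w' j).
Proof.
move=> full_ab le_i le_j.
have le_ab : a <= b <= 2 * r by move: full_ab; rewrite /full_climb; lia.
apply: walk_cat (straight_walk w le_i _) _; first lia.
apply: walk_cat _ (straight_walk w' _ le_j); last lia.
apply: benes_up_walk => // t _; have lt_t := ltn_ord t.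
case/orP: full_ab => [/andP[/eqP-> le_b] | /andP[le_a /eqP->]].
  (* Position [t] is met at level [t] in the first half and at the mirror level [2 * r - 1 - t] in
     the second. *)
  by exists t; rewrite /benes_bit; [lia | case: ltnP; lia].
by exists (2 * r - 1 - t); rewrite /benes_bit; [lia | case: ltnP; lia].
Qed.

Lemma benes_diameter u v : exists2 n, n <= 2 * r & walk n u v.
Proof.
wlog le_uv : u v / u.2 <= v.2.
  move=> gen; case: (leqP u.2 v.2) => [/gen // | /ltnW/gen[n le_n vu]].
  by exists n => //; apply: walk_sym.
rewrite -[u]bvertexK -[v]bvertexK.
have le_u : u.2 <= 2 * r by rewrite -ltnS.
have le_v : v.2 <= 2 * r by rewrite -ltnS.
move: (nat_of_ord u.2) (nat_of_ord v.2) le_uv le_u le_v => i j le_ij le_i le_j.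
suff [a [b [full_ab le_n]]] : exists a b, full_climb a b /\
    (i - a + (a - i)) + ((b - a) + (b - j + (j - b))) <= 2 * r.
  by eexists; [exact: le_n | exact: full_climb_walk].
(* With [i <= j], both ends in one half cost [2 * r - (j - i)]. Ends in different halves cost
   [i + j] via level 0 or [4 * r - (i + j)] via level [2 * r], and the smaller is at most
   [2 * r]. *)
rewrite /full_climb; case: (leqP j r) => [le_jr | lt_rj].
  by exists 0, r; lia.
case: (leqP r i) => [le_ri | lt_ir]; first by exists r, (2 * r); lia.
case: (leqP (i + j) (2 * r)) => [le_s | lt_s]; first by exists 0, j; lia.
by exists i, (2 * r); lia.
Qed.

Definition row w : seq (BN r) := [seq bvertex w i | i <- iota 0 (2 * r).+1].

Lemma mem_row w u : (u \in row w) = (u.1 == w).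
Proof.
apply/mapP/eqP => [[i _ ->] // | <-]; exists (u.2 : nat); last by rewrite bvertexK.
by rewrite mem_iota add0n /= ltn_ord.
Qed.

Lemma row_is_path w : is_path (row w).
Proof.
have uniq_row : uniq (row w).
  rewrite map_inj_in_uniq ?iota_uniq // => i j.
  rewrite !mem_iota !add0n => lt_i lt_j eq_ij.
  by rewrite -(@bvertex_level w i) // eq_ij bvertex_level.
rewrite -[is_path _]/(path _ (bvertex w 0) (map (bvertex w) (iota 1 (2 * r))) && _).
rewrite uniq_row andbT.
apply/(pathP (bvertex w 0)) => i; rewrite size_map size_iota => lt_i.
have nth_row k : k <= 2 * r -> nth (bvertex w 0) (row w) k = bvertex w k.
  by move=> le_k; rewrite (nth_map 0) ?size_iota // nth_iota.
rewrite -[_ :: _]/(row w) -[map _ _]/(behead (row w)) nth_behead.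
rewrite (nth_row _ (ltnW lt_i)) (nth_row _ lt_i).
apply/orP; left.
by rewrite /benes_up (bvertex_level w (ltnW lt_i)) (bvertex_level w lt_i) !eqxx.
Qed.

Lemma row_isometric w : isometric_path (row w).
Proof.
split=> [|x y xy]; first exact: row_is_path.
split=> [|s]; first by exists (row w).
(* The default 0 is the level of the head of the row. *)
have last_iota n : last 0 (iota 1 n) = n.
  by case: n => // n; rewrite -[in LHS](addn1 n) iotaD last_cat.
case/and3P: xy => _ /= /eqP <-.
rewrite size_map size_iota (last_map (bvertex w)) last_iota => /eqP<-.
(* Any competing path climbs from level 0 to level [2 * r], at most one level per edge. *)
case: s => // x' p /and3P[/= /andP[/path_level le_p _] /eqP xx' /eqP last_p].
by move: le_p; rewrite last_p xx' !bvertex_level.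
Qed.

Lemma row_partition : isometric_partition [seq row w | w : r.-tuple bool].
Proof.
split; first split.
- by move=> s /mapP[w _ ->]; apply: row_isometric.
- by move=> u; exists (row u.1); rewrite ?mem_row // map_f ?mem_enum.
rewrite pairwise_map; have := enum_uniq {: r.-tuple bool}; rewrite uniq_pairwise.
apply: sub_pairwise => w w' /= ne_w; rewrite disjoint_has; apply/hasPn => u.
by rewrite !mem_row => /eqP->.
Qed.

End BenesNetwork.

Theorem theorem9 (r : nat) (hr : 1 <= r) :
  ip_c (BN r) = 2 ^ r /\ ip_p (BN r) = 2 ^ r.
Proof.
apply: ip_c_ip_p_eq (row_partition r) _ _.
  by rewrite size_map -cardE card_tuple card_bool.
move=> qs /(isometric_cover_card (@benes_diameter r)).
(* The common factor [(2 * r).+1], the number of levels, cancels. *)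
by rewrite card_prod card_tuple card_bool card_ord leq_pmul2r.
Qed.
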